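(* Let $d$ be a positive integer. For any $5$-design POVM $\pi_y$ on a $d$-dimensional complex Hilbert space, the informational power satisfies $W(\pi_y)\le W_5(d)$, where $$W_5(d) := \ln d + \frac{(d-1)(d+3)(d^2+2d+4)}{2d(d+1)^2(d+2)} \ln \frac{6}{(d+3)(d+4)} + \frac{\sqrt{d+3}\,(d-1)(d^2-2d-12)}{2\sqrt3\, d\,(d+1)^{3/2}(d+2)} \ln \frac{2d+5-\sqrt{3(d+1)(d+3)}}{d+4}.$$
   Context: Let $\mathcal{H}$ be a $d$-dimensional complex Hilbert space. A state is a positive semidefinite operator $\rho$ on $\mathcal{H}$ with $\operatorname{Tr}[\rho]\le 1$; an effect is a positive semidefinite operator $\pi \le \mathbb{1}_d$. An ensemble is a measurable function $x\mapsto\rho_x$ from the reals to states with $\int \operatorname{Tr}[\rho_x]\,dx = 1$. A POVM is a measurable function $y\mapsto\pi_y$ from the reals to effects with $\int \pi_y\,dy = \mathbb{1}_d$. Finite ensembles and finite POVMs are included (sums in place of integrals, or equivalently step functions). A POVM $\pi_y$ is a $t$-design POVM if the ensemble $\pi_y/d$ is a spherical quantum $t$-design, i.e. for every integer $1\le k\le t$, $\int \frac{\pi_y^{\otimes k}}{\operatorname{Tr}[\pi_y]^{k-1}}\,dy = d\binom{d-1+k}{k}^{-1} P_{\mathrm{sym}}$, where $P_{\mathrm{sym}}$ is the orthogonal projector onto the symmetric subspace of $\mathcal{H}^{\otimes k}$ (the right-hand side is $d$ times the corresponding average over pure states distributed with the uniform (Haar) measure on the unit sphere); the integrand is $0$ where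 $\pi_y=0$. For an ensemble $\rho_x$ and a POVM $\pi_y$, let $p_{x,y}=\operatorname{Tr}[\rho_x\pi_y]$ with marginals $p_x,p_y$; the mutual information is $I(\rho_x,\pi_y) := \iint p_{x,y}\ln\frac{p_{x,y}}{p_xp_y}\,dx\,dy$ (with $0\ln 0=0$). The informational power is $W(\pi_y) := \sup_{\rho_x} I(\rho_x,\pi_y)$, the supremum being over all ensembles. *)

(* Defs.v *)
(* Libraries: MathComp, MathComp-Analysis, and the complex numbers R[i] of
   mathcomp-real-closed.  The d-dimensional Hilbert space is C^d, its operators
   are d x d complex matrices acting on column vectors. *)

From mathcomp Require Import all_boot all_order all_algebra all_fingroup.
From mathcomp Require Import spectral sesquilinear.
From mathcomp Require Import complex.
From mathcomp Require Import all_classical all_reals all_analysis.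

Set Implicit Arguments.
Unset Strict Implicit.
Unset Printing Implicit Defensive.

Import Order.TTheory GRing.Theory Num.Theory.
Import numFieldNormedType.Exports.

Local Open Scope classical_set_scope.
Local Open Scope ring_scope.
Local Open Scope complex_scope.
Local Open Scope sesquilinear_scope.

Section Operators.
Context {R : realType}.
Local Notation C := R[i].

(* In C, [0 <= z] says that z is real and nonnegative. *)
Definition psdmx (n : nat) (A : 'M[C]_n) : Prop :=
  A \is hermsymmx /\ forall v : 'cV[C]_n, 0 <= (v ^t* *m A *m v) 0 0.

Definition is_state (d : nat) (A : 'M[C]_d) : Prop := psdmx A /\ \tr A <= 1.

Definition is_effect (d : nat) (A : 'M[C]_d) : Prop :=
  psdmx A /\ psdmx (1%:M - A).

(* The canonical basis of the k-th tensor power of C^d consists of the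
   e_(f 0) (x) ... (x) e_(f (k-1)), for f : 'I_k -> 'I_d; it is enumerated by
   [enum_rank], [enum_val]. *)
Definition tensor_dim (d k : nat) : nat := #|{: {ffun 'I_k -> 'I_d}}|.

Definition tensor_pow (d k : nat) (A : 'M[C]_d) : 'M[C]_(tensor_dim d k) :=
  \matrix_(i, j)
    let f : {ffun 'I_k -> 'I_d} := enum_val i in
    let g : {ffun 'I_k -> 'I_d} := enum_val j in
    \prod_(l < k) A (f l) (g l).

Definition sym_tensor (d k : nat) (v : 'cV[C]_(tensor_dim d k)) : Prop :=
  forall (s : 'S_k) (f : {ffun 'I_k -> 'I_d}),
    v (enum_rank [ffun l => f (s l)]) 0 = v (enum_rank f) 0.

Definition orthogonal_projector (n : nat) (V : 'cV[C]_n -> Prop)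
    (P : 'M[C]_n) : Prop :=
  [/\ P \is hermsymmx, P *m P = P &
      forall v : 'cV[C]_n, V v <-> exists u : 'cV[C]_n, v = P *m u].

End Operators.

Section Integrals.
Context {R : realType}.
Local Notation C := R[i].
Local Notation mu := (@lebesgue_measure R).

Definition measurable_mx (m n : nat) (F : R -> 'M[C]_(m, n)) : Prop :=
  forall i j, measurable_fun [set: R] (fun x => complex.Re (F x i j)) /\
              measurable_fun [set: R] (fun x => complex.Im (F x i j)).

Definition integrable_mx (m n : nat) (F : R -> 'M[C]_(m, n)) : Prop :=
  forall i j,
    mu.-integrable [set: R] (fun x => (complex.Re (F x i j))%:E) /\
    mu.-integrable [set: R] (fun x => (complex.Im (F x i j))%:E).

Definition integral_mx (m n : nat) (F : R -> 'M[C]_(m, n)) : 'M[C]_(m, n) :=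
  \matrix_(i, j) ((\int[mu]_x complex.Re (F x i j)) +i*
                  (\int[mu]_x complex.Im (F x i j))).

End Integrals.

Section Ensembles.
Context {R : realType}.
Local Notation C := R[i].
Local Notation mu := (@lebesgue_measure R).

(* Finite ensembles and POVMs are the step functions among the following ones:
   the n-th element is the value on [n, n + 1[. *)
Definition ensemble (d : nat) (rho : R -> 'M[C]_d) : Prop :=
  [/\ measurable_mx rho, forall x, is_state (rho x) &
      (\int[mu]_x (complex.Re (\tr (rho x)))%:E = 1)%E].

Definition povm (d : nat) (p : R -> 'M[C]_d) : Prop :=
  [/\ measurable_mx p, forall y, is_effect (p y),
      integrable_mx p & integral_mx p = 1%:M].

(* Where [p y = 0] the integrand is 0, since [0^-1 = 0]. *)
Definition design_integrand (d k : nat) (p : R -> 'M[C]_d) (y : R) :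
    'M[C]_(tensor_dim d k) :=
  (\tr (p y) ^+ k.-1)^-1 *: tensor_pow k (p y).

Definition design_povm (d t : nat) (p : R -> 'M[C]_d) : Prop :=
  povm p /\
  forall k : nat, (1 <= k <= t)%N ->
    integrable_mx (design_integrand k p) /\
    exists2 Psym : 'M[C]_(tensor_dim d k),
      orthogonal_projector (@sym_tensor R d k) Psym &
      integral_mx (design_integrand k p) =
        (d%:R / 'C(d.-1 + k, k)%:R) *: Psym.

(* Tr[rho_x p_y] is a real number, as both operators are Hermitian. *)
Definition joint_density (d : nat) (rho p : R -> 'M[C]_d) (x y : R) : R :=
  complex.Re (\tr (rho x *m p y)).

Definition marginal_x (d : nat) (rho p : R -> 'M[C]_d) (x : R) : R :=
  \int[mu]_y joint_density rho p x y.

Definition marginal_y (d : nat) (rho p : R -> 'M[C]_d) (y : R) : R :=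
  \int[mu]_x joint_density rho p x y.

Definition mutual_information (d : nat) (rho p : R -> 'M[C]_d) : \bar R :=
  (\int[mu \x mu]_z
     (joint_density rho p z.1 z.2 *
      ln (joint_density rho p z.1 z.2 /
          (marginal_x rho p z.1 * marginal_y rho p z.2)))%:E)%E.

Definition informational_power (d : nat) (p : R -> 'M[C]_d) : \bar R :=
  ereal_sup [set mutual_information rho p | rho in @ensemble d].

End Ensembles.

Definition W5 (R : realType) (d : nat) : R :=
  let D : R := d%:R in
  ln D
  + (D - 1) * (D + 3) * (D ^+ 2 + 2 * D + 4) / (2 * D * (D + 1) ^+ 2 * (D + 2))
    * ln (6 / ((D + 3) * (D + 4)))
  + Num.sqrt (D + 3) * (D - 1) * (D ^+ 2 - 2 * D - 12)
      / (2 * Num.sqrt 3 * D * (D + 1) `^ (3 / 2) * (D + 2))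
    * ln ((2 * D + 5 - Num.sqrt (3 * (D + 1) * (D + 3))) / (D + 4)).

(* Main.v *)
(* By concavity of the logarithm, replacing the marginal density of y by
   Tr[pi_y]/d can only increase the mutual information, so
   I <= ln d + \int\int p_x Tr[pi_y] t ln t with t = p_xy / (p_x Tr[pi_y]);
   by convexity of t ln t and the spectral theorem, the inner integral over y is
   largest when rho_x has rank one.  There t ln t <= t Q(t) on [0, 1], where the
   quartic Q interpolates ln at 1 and, to first order, at two nodes a < b, and
   \int Tr[pi_y] t^k dy is given by the design property for k <= 5.  For a, b the
   roots of the quadratic orthogonal polynomial of the weight t (1 - t)^(d-1),
   the resulting bound depends on ln a and ln b only, and it is W5. *)

Require Import Defs.
From mathcomp Require Import all_boot all_order all_algebra all_fingroup.
From mathcomp Require Import spectral sesquilinear.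
From mathcomp Require Import complex.
From mathcomp Require Import all_classical all_reals all_analysis.
From mathcomp Require Import measurable_realfun.
From mathcomp Require Import ring lra.

Set Implicit Arguments.
Unset Strict Implicit.
Unset Printing Implicit Defensive.

Import Order.TTheory GRing.Theory Num.Theory.
Import numFieldNormedType.Exports.
Local Open Scope classical_set_scope.
Local Open Scope ring_scope.

(** * Integrals *)

Section HasIntegral.
Context {dT : measure_display} {T : measurableType dT} {R : realType}.
Variable mu : {measure set T -> \bar R}.
Implicit Types (f g : T -> R) (a b c : R).

(** Integrability and value are bundled, so that the rules of linearity compose without side
    conditions. *)
Definition has_integral f a : Prop :=
  mu.-integrable [set: T] (EFin \o f) /\ (\int[mu]_x (f x)%:E = a%:E)%E.

Lemma integrable_has_integral f : mu.-integrable [set: T] (EFin \o f) ->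
  has_integral f (\int[mu]_x f x).
Proof.
move=> fi; split => //; rewrite /Rintegral fineK //.
exact: (integrable_fin_num measurableT fi).
Qed.

Lemma has_integral_measurable f a : has_integral f a -> measurable_fun [set: T] f.
Proof. by move=> [/measurable_int/measurable_EFinP]. Qed.

Lemma has_integralZ c f a : has_integral f a ->
  has_integral (fun x => c * f x) (c * a).
Proof.
move=> [fi fa]; split; first exact: (integrableZl measurableT c fi).
under eq_integral do rewrite EFinM.
by rewrite integralZl // fa EFinM.
Qed.

Lemma has_integralD f g a b : has_integral f a -> has_integral g b ->
  has_integral (fun x => f x + g x) (a + b).
Proof.
move=> [fi fa] [gi gb]; split; first exact: (integrableD measurableT fi gi).
under eq_integral do rewrite EFinD.
by rewrite integralD // fa gb EFinD.
Qed.

Lemma has_integralB f g a b : has_integral f a -> has_integral g b ->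
  has_integral (fun x => f x - g x) (a - b).
Proof.
move=> hf hg; have := has_integralD hf (has_integralZ (-1) hg).
rewrite mulN1r; congr has_integral; apply/funext => x; rewrite mulN1r //.
Qed.

Lemma has_integral0 : has_integral (cst 0) 0.
Proof. by split; [exact: integrable0 | rewrite integral0]. Qed.

Lemma has_integral_sum I (r : seq I) (F : I -> T -> R) (s : I -> R) :
  (forall i, has_integral (F i) (s i)) ->
  has_integral (fun x => \sum_(i <- r) F i x) (\sum_(i <- r) s i).
Proof.
move=> H; elim: r => [|i r IH].
  rewrite big_nil; have := has_integral0; congr has_integral.
  by apply/funext => x; rewrite big_nil.
rewrite big_cons; have := has_integralD (H i) IH; congr has_integral.
by apply/funext => x; rewrite big_cons.
Qed.

Lemma ge0_has_integral f a : measurable_fun [set: T] f -> (forall x, 0 <= f x) ->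
  (\int[mu]_x (f x)%:E = a%:E)%E -> has_integral f a.
Proof.
move=> mf f0 fa; split => //; apply/integrableP; split; first exact/measurable_EFinP.
under eq_integral => x _ do rewrite /= ger0_norm ?f0 //.
by rewrite fa ltry.
Qed.

Lemma ge0_le_has_integral f g b : measurable_fun [set: T] f ->
  (forall x, 0 <= f x <= g x) -> has_integral g b ->
  exists2 a, a <= b & has_integral f a.
Proof.
move=> mf fg [gi gb].
have fi : mu.-integrable [set: T] (EFin \o f).
  apply: (le_integrable measurableT _ _ gi); first exact/measurable_EFinP.
  move=> x _ /=; have /andP[f0 fgx] := fg x.
  by rewrite lee_fin !ger0_norm // (le_trans f0).
have hf := integrable_has_integral fi.
exists (\int[mu]_x f x) => //; rewrite -lee_fin -gb; case: hf => _ <-.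
by apply: (le_integral measurableT fi gi) => x _ /=; rewrite lee_fin; case/andP: (fg x).
Qed.

(** The integral of [f] may be -oo, so the positive parts and the negative parts are compared
    separately. *)
Lemma ae_le_integral_has_integral f g a : measurable_fun [set: T] f ->
  has_integral g a -> (\forall x \ae mu, f x <= g x) ->
  (\int[mu]_x (f x)%:E <= a%:E)%E.
Proof.
move=> mf [gi <-] fg.
have mF : measurable_fun [set: T] (EFin \o f) by exact/measurable_EFinP.
have mG := measurable_int mu gi.
rewrite integralE [leRHS]integralE; apply: leeB.
  apply: ae_ge0_le_integral => //; try exact: measurable_funepos.
  by apply: filterS fg => x fgx _; rewrite !funeposE /= ge_max !le_max lexx lee_fin fgx orbT.
apply: ae_ge0_le_integral => //; try exact: measurable_funeneg.
by apply: filterS fg => x fgx _; rewrite !funenegE /= ge_max !le_max lexx lee_fin lerN2 fgx orbT.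
Qed.

End HasIntegral.

(** * Inequalities for the logarithm *)

Lemma ln_le_sub1 (R : realType) (x : R) : 0 < x -> ln x <= x - 1.
Proof.
by move=> x0; have := @le_ln1Dx R (x - 1); rewrite addrCA subrr addr0; apply; lra.
Qed.

(** From ln (y / x) <= y / x - 1 follows x ln (x / y) >= x - y. The bound by [y] is what makes the
    entropy density integrable. *)
Lemma mul_ln_div_ge (R : realType) (x y : R) : 0 <= x <= y -> - y <= x * ln (x / y) <= 0.
Proof.
move=> /andP[x0 xy]; have [->|xn0] := eqVneq x 0; first by rewrite mul0r; lra.
have xp : 0 < x by rewrite lt0r xn0.
have yp : 0 < y by lra.
have := @ln_le_sub1 R (y / x); rewrite divr_gt0 // => /(_ isT) H.
rewrite -invf_div lnV ?posrE ?divr_gt0 // mulrN; apply/andP; split.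
  rewrite lerN2; apply: (@le_trans _ _ (x * (y / x - 1))); first by rewrite ler_pM2l.
  by rewrite mulrBr mulrC divfK //; lra.
by rewrite oppr_le0 mulr_ge0 // ln_ge0 // ler_pdivlMr // mul1r.
Qed.

(** On nonnegative reals the inverse is the power of exponent -1, also at 0, where both are 0. *)
Lemma measurable_funV d (T : measurableType d) (R : realType) (f : T -> R) :
  measurable_fun [set: T] f -> (forall x, 0 <= f x) ->
  measurable_fun [set: T] (fun x => (f x)^-1).
Proof.
move=> mf f0; under eq_fun do rewrite -powR_inv1 //.
by apply: (measurableT_comp (measurable_powR (R := R) (-1)) mf).
Qed.

(** The log-sum inequality, which expresses the convexity of t ln t. It reduces a positive operator
    to its eigenvectors, the [l i] being the eigenvalues. *)
Lemma log_sum_le (R : realType) (n : nat) (l s : 'I_n -> R) (T : R) :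
  (forall i, 0 <= l i) -> (forall i, 0 <= s i <= T) ->
  (\sum_i l i * s i) * ln ((\sum_i l i * s i) / ((\sum_i l i) * T)) <=
    \sum_i l i * (s i * ln (s i / T)).
Proof.
move=> l0 sT; set f := \sum_i l i * s i; set P := \sum_i l i.
have s0 i : 0 <= s i by case/andP: (sT i).
have ls0 i : 0 <= l i * s i by exact: mulr_ge0.
have : 0 <= f by apply: sumr_ge0.
rewrite le_eqVlt => /predU1P[/esym fz|fp].
  rewrite fz mul0r sumr_ge0 // => i _.
  have lsz : l i * s i = 0 by exact: (psumr_eq0P (fun i _ => ls0 i) fz).
  by move/eqP: lsz; rewrite mulf_eq0 => /orP[] /eqP ->; rewrite !(mul0r, mulr0).
have Pp : 0 < P.
  rewrite lt0r sumr_ge0 // andbT; apply: contraTneq fp => Pz.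
  rewrite /f big1 ?ltxx // => i _.
  have -> : l i = 0 by exact: (psumr_eq0P (fun i _ => l0 i) Pz).
  exact: mul0r.
(* Each term is ln x <= x - 1 at x = f / (P * s i); the corrections l i * (f / P - s i) sum to 0. *)
apply: (@le_trans _ _ (\sum_i (l i * (s i * ln (s i / T)) + l i * (f / P - s i)))).
  rewrite {1}/f mulr_suml; apply: ler_sum => i _.
  have [si|si] := eqVneq (s i) 0.
    by rewrite si !(mulr0, mul0r) subr0 add0r mulr_ge0 // divr_ge0 // ltW.
  have sp : 0 < s i by rewrite lt0r si s0.
  have Tp : 0 < T by case/andP: (sT i) => _; exact: lt_le_trans.
  rewrite -mulrA -mulrDr ler_wpM2l //.
  have gp : 0 < f / (P * s i) by rewrite divr_gt0 // mulr_gt0.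
  have tp : 0 < s i / T by rewrite divr_gt0.
  have -> : f / (P * T) = s i / T * (f / (P * s i)) by field; rewrite !gt_eqF.
  rewrite (lnM (tp : _ \in Num.pos) (gp : _ \in Num.pos)) mulrDr lerD2l.
  have := ln_le_sub1 gp; rewrite -(ler_pM2l sp) => /le_trans; apply.
  by rewrite le_eqVlt; apply/orP; left; apply/eqP; field; rewrite !gt_eqF.
rewrite big_split /= gerDl.
under [X in X <= 0]eq_bigr do rewrite mulrBr.
by rewrite sumrB -mulr_suml -/P -/f mulrC divfK ?gt_eqF // subrr.
Qed.

(** * Mutual information of a joint density *)

Section MutualInformation.
Context d1 d2 (T1 : measurableType d1) (T2 : measurableType d2) (R : realType).
Variables (m1 : {sigma_finite_measure set T1 -> \bar R})
          (m2 : {sigma_finite_measure set T2 -> \bar R}).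
(** In the application [f] is the joint density, [P] and [T] are the traces of the states and of the
    effects, [D] is the dimension, and [K] bounds the entropy integral over y per unit of [P x]. *)
Variables (f : T1 -> T2 -> R) (P : T1 -> R) (T : T2 -> R) (D K : R).
Hypothesis mf : measurable_fun [set: T1 * T2] (fun z => f z.1 z.2).
Hypothesis f0 : forall x y, 0 <= f x y.
Hypothesis fP : forall x y, f x y <= P x.
Hypothesis fPT : forall x y, f x y <= P x * T y.
Hypothesis T0 : forall y, 0 <= T y.
Hypothesis D0 : 0 < D.
Hypothesis hP : has_integral m1 P 1.
Hypothesis hT : has_integral m2 T D.
Hypothesis hf : forall x, (\int[m2]_y (f x y)%:E = (P x)%:E)%E.
Hypothesis hK : forall x,
  (\int[m2]_y (f x y * ln (f x y / (P x * T y)))%:E <= (P x * K)%:E)%E.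

Let P0 x : 0 <= P x.
Proof. by rewrite -lee_fin -hf; apply: integral_ge0 => y _; rewrite lee_fin. Qed.

Let q y : R := \int[m1]_x f x y.

Let mP : measurable_fun [set: T1] P := has_integral_measurable hP.
Let mT : measurable_fun [set: T2] T := has_integral_measurable hT.

(** Domination by the integrable [P] makes the marginal finite at every y. *)
Let qE y : (\int[m1]_x (f x y)%:E = (q y)%:E)%E.
Proof.
have mfy : measurable_fun [set: T1] (fun x => f x y).
  exact: (measurableT_comp mf (pair2_measurable y)).
have fyP x : 0 <= f x y <= P x by rewrite f0 fP.
have [c _ [_ fc]] := ge0_le_has_integral mfy fyP hP.
by rewrite /q /Rintegral fc.
Qed.

Let q0 y : 0 <= q y.
Proof. by apply: Rintegral_ge0 => x _. Qed.

Let mq : measurable_fun [set: T2] q.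
Proof.
apply/measurable_EFinP.
have -> : EFin \o q = fubini_G m1 (fun z => (f z.1 z.2)%:E).
  by apply/funext => y; rewrite /fubini_G /= qE.
apply: measurable_fun_fubini_tonelli_G; last by move=> z; rewrite lee_fin.
exact/measurable_EFinP.
Qed.

Let mfst (g : T1 -> R) : measurable_fun [set: T1] g ->
  measurable_fun [set: T1 * T2] (fun z => g z.1).
Proof. by move=> mg; exact: (measurableT_comp mg measurable_fst). Qed.

Let msnd (g : T2 -> R) : measurable_fun [set: T2] g ->
  measurable_fun [set: T1 * T2] (fun z => g z.2).
Proof. by move=> mg; exact: (measurableT_comp mg measurable_snd). Qed.

Let mPT : measurable_fun [set: T1 * T2] (fun z => P z.1 * T z.2).
Proof. by apply: measurable_funM; [exact: mfst | exact: msnd]. Qed.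

Let PT0 (z : T1 * T2) : 0 <= P z.1 * T z.2.
Proof. by rewrite mulr_ge0. Qed.

Let tonelli1 (g : T1 * T2 -> R) : measurable_fun setT g -> (forall z, 0 <= g z) ->
  (\int[m1 \x m2]_z (g z)%:E = \int[m1]_x \int[m2]_y (g (x, y))%:E)%E.
Proof.
move=> mg g0; apply: fubini_tonelli1; last by move=> z; rewrite lee_fin.
exact/measurable_EFinP.
Qed.

Let tonelli2 (g : T1 * T2 -> R) : measurable_fun setT g -> (forall z, 0 <= g z) ->
  (\int[m1 \x m2]_z (g z)%:E = \int[m2]_y \int[m1]_x (g (x, y))%:E)%E.
Proof.
move=> mg g0; rewrite tonelli1 //.
apply: (@fubini_tonelli _ _ _ _ _ m1 m2 (fun z => (g z)%:E)); last by move=> z; rewrite lee_fin.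
exact/measurable_EFinP.
Qed.

Let hF : has_integral (m1 \x m2)%E (fun z => f z.1 z.2) 1.
Proof.
apply: ge0_has_integral => //; rewrite tonelli1 //=.
by under eq_integral do rewrite hf; case: hP.
Qed.

Let hPT : has_integral (m1 \x m2)%E (fun z => P z.1 * T z.2) D.
Proof.
apply: ge0_has_integral => //; rewrite tonelli1 //=.
transitivity (\int[m1]_x (P x * D)%:E)%E.
  apply: eq_integral => x _.
  by have [_ ->] := has_integralZ (P x) hT.
by have [_] := has_integralZ D hP; rewrite mulr1; under eq_integral do rewrite mulrC.
Qed.

(** Integrating over x first, [f] restricted to the set where [q] vanishes has integral 0. Off a
    null set, one may thus divide by [q] wherever [f] is nonzero. *)
Let ae_q : {ae (m1 \x m2)%E, forall z, q z.2 = 0 -> f z.1 z.2 = 0}.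
Proof.
pose g (z : T1 * T2) := f z.1 z.2 * \1_(q @^-1` [set 0]) z.2.
have mg : measurable_fun setT g.
  apply: measurable_funM => //; apply: msnd; apply: measurable_indic.
  by rewrite -[X in measurable X]setTI; apply: mq.
have g0 z : 0 <= g z by rewrite mulr_ge0.
have : (\int[m1 \x m2]_z `|(g z)%:E| = 0)%E.
  under eq_integral do rewrite gee0_abs ?lee_fin //.
  rewrite tonelli2 //= integral0_eq // => y _.
  have [qy|qy] := eqVneq (q y) 0; last first.
    rewrite integral0_eq // => x _.
    by rewrite /g indicE memNset ?mulr0 //= => /eqP; apply/negP.
  rewrite -[RHS]/(0%:E) -qy -qE; apply: eq_integral => x _.
  by rewrite /g indicE mem_set ?mulr1.
move/ae_eq_integral_abs => /(_ measurableT) H.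
have mG : measurable_fun setT (EFin \o g) by exact/measurable_EFinP.
have := H mG; apply: filterS => z /(_ I) [] + qz; rewrite /g indicE mem_set ?mulr1 //.
Qed.

(** The sign is chosen so that [N] is nonnegative and Tonelli applies. *)
Let N z := - (f z.1 z.2 * ln (f z.1 z.2 / (P z.1 * T z.2))).

Let N_bnd z : 0 <= N z <= P z.1 * T z.2.
Proof.
have := @mul_ln_div_ge R (f z.1 z.2) (P z.1 * T z.2); rewrite f0 fPT => /(_ isT).
by rewrite /N => /andP[? ?]; apply/andP; split; lra.
Qed.

Let mN : measurable_fun setT N.
Proof.
apply: measurableT_comp => //; apply: measurable_funM => //.
apply: (measurableT_comp (@measurable_ln R)); apply: measurable_funM => //.
exact: measurable_funV.
Qed.

Let hN : exists2 c, - K <= c & has_integral (m1 \x m2)%E N c.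
Proof.
have [c _ Nc] := ge0_le_has_integral mN N_bnd hPT; exists c => //.
have N0 z : 0 <= N z by case/andP: (N_bnd z).
(* For K >= 0 the positivity of [N] suffices. Otherwise -K * P is nonnegative, and the inner
   integrals over y are compared with it. *)
have [K0|K0] := leP 0 K.
  have : (0 <= c%:E)%E by rewrite -(proj2 Nc); apply: integral_ge0 => z _; rewrite lee_fin.
  rewrite lee_fin.
  lra.
rewrite -lee_fin -(proj2 Nc) tonelli1 //.
have [_ <-] : has_integral m1 (fun x => - K * P x) (- K).
  by have := has_integralZ (- K) hP; rewrite mulr1.
apply: ge0_le_integral => //.
- by move=> x _; rewrite lee_fin mulr_ge0 //; lra.
- by apply/measurable_EFinP; apply: measurable_funM.
- apply: (@measurable_fun_fubini_tonelli_F _ _ _ _ _ m2 (fun z => (N z)%:E)).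
    exact/measurable_EFinP.
  by move=> z; rewrite lee_fin.
move=> x _; have := hK x.
under eq_integral => y _ do rewrite -[_ * _]opprK -/(N (x, y)) EFinN.
rewrite integral_ge0N; last by move=> y _; rewrite lee_fin.
by rewrite leeNl -EFinN mulNr mulrC.
Qed.

(** Where [q] is nonzero, [h] is [f] rescaled so that its marginal in y becomes T / D. *)
Let h z := T z.2 / (D * q z.2) * f z.1 z.2.

(** The marginal of [h] in y is T / D, or 0 where [q] vanishes, and T / D has integral 1. *)
Let hh : exists2 c, c <= 1 & has_integral (m1 \x m2)%E h c.
Proof.
have h0 z : 0 <= h z by rewrite !mulr_ge0 // invr_ge0 mulr_ge0 // ltW.
have mc : measurable_fun [set: T2] (fun y => T y / (D * q y)).
  apply: measurable_funM => //; apply: measurable_funV => [|y].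
    exact: measurable_funM.
  by rewrite mulr_ge0 // ltW.
have mh : measurable_fun setT h by exact: (measurable_funM (msnd mc) mf).
have hE y : (\int[m1]_x (h (x, y))%:E = (T y / (D * q y) * q y)%:E)%E.
  rewrite /h /=; under eq_integral do rewrite EFinM.
  rewrite ge0_integralZl //.
  - by rewrite qE.
  - by apply/measurable_EFinP; exact: (measurableT_comp mf (pair2_measurable y)).
  - by move=> x _; rewrite lee_fin.
  - by rewrite lee_fin mulr_ge0 // invr_ge0 mulr_ge0 // ltW.
have [c c1 [_ hc]] : exists2 c, c <= 1 & has_integral m2 (fun y => T y / (D * q y) * q y) c.
  have : has_integral m2 (fun y => D^-1 * T y) 1.
    by have := has_integralZ D^-1 hT; rewrite mulVf // gt_eqF.
  apply: ge0_le_has_integral => [|y]; first exact: measurable_funM.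
  have [->|qn] := eqVneq (q y) 0.
    by rewrite mulr0 lexx mulr_ge0 // invr_ge0 ltW.
  have -> : T y / (D * q y) * q y = D^-1 * T y by field; rewrite qn gt_eqF.
  by rewrite lexx mulr_ge0 // invr_ge0 ltW.
exists c => //; apply: ge0_has_integral => //; rewrite tonelli2 //.
by under eq_integral do rewrite hE.
Qed.

(** With g = T / (D * q), the logarithm of f / (P * q) is the sum of those of f / (P * T), D and g.
    Since ln g <= g - 1, the integrand is almost everywhere at most ln D * f - N + h - f. *)
Lemma mutual_information_le :
  (\int[m1 \x m2]_z
     (f z.1 z.2 * ln (f z.1 z.2 / ((\int[m2]_y f z.1 y) * (\int[m1]_x f x z.2))))%:E
   <= (ln D + K)%:E)%E.
Proof.
have [cN KN iN] := hN; have [ch h1 ih] := hh.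
have := has_integralB (has_integralD (has_integralB (has_integralZ (ln D) hF) iN) ih) hF.
move=> iG.
set G := fun z => _ in iG.
apply: (@le_trans _ _ (ln D * 1 - cN + ch - 1)%:E); last by rewrite lee_fin; lra.
have PE x : \int[m2]_y f x y = P x by rewrite /Rintegral hf.
under eq_integral do rewrite PE -/(q _).
apply: ae_le_integral_has_integral iG _.
  apply: measurable_funM => //; apply: (measurableT_comp (@measurable_ln R)).
  apply: measurable_funM => //; apply: measurable_funV => [|z]; last by rewrite mulr_ge0.
  by apply: measurable_funM; [exact: mfst | exact: msnd].
apply: filterS ae_q => -[x y] /= qf0; rewrite /G /N /h /=.
have [fz|fn] := eqVneq (f x y) 0; first by rewrite fz !(mul0r, mulr0) !(subr0, oppr0, addr0).
have fp : 0 < f x y by rewrite lt0r fn f0.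
have qp : 0 < q y.
  by rewrite lt0r q0 andbT; apply: contra_neq fn.
have Pp : 0 < P x by exact: lt_le_trans fp (fP x y).
have Tp : 0 < T y.
  rewrite lt0r T0 andbT; apply: contraTneq fp => Ty.
  by rewrite -leNgt (le_trans (fPT x y)) // Ty mulr0.
have -> : f x y / (P x * q y) = f x y / (P x * T y) * (D * (T y / (D * q y))).
  by field; rewrite !gt_eqF.
have gp : 0 < T y / (D * q y) by rewrite divr_gt0 // mulr_gt0.
have tp : 0 < f x y / (P x * T y) by rewrite divr_gt0 // mulr_gt0.
have Dg : 0 < D * (T y / (D * q y)) by rewrite mulr_gt0.
rewrite (lnM (tp : _ \in Num.pos) (Dg : _ \in Num.pos)).
rewrite (lnM (D0 : _ \in Num.pos) (gp : _ \in Num.pos)).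
have := ln_le_sub1 gp; rewrite -(ler_pM2l fp).
set A := ln _; set B := ln _; set E := ln _; set g := T y / _.
nra.
Qed.

End MutualInformation.

(** * Hermite interpolation of the logarithm *)

Section HermiteLog.
Context {R : realType}.
Implicit Types (q : {poly R}) (a b t : R).

Lemma MVT_is_derive (f df : R -> R) a b : a < b ->
  (forall x, a <= x <= b -> is_derive x 1 f (df x)) ->
  exists2 c, a < c < b & f b - f a = df c * (b - a).
Proof.
move=> ab fE; have [] := @MVT R f df a b ab.
- by move=> x; rewrite in_itv /= => /andP[ax xb]; apply: fE; rewrite !ltW.
- apply: derivable_within_continuous => x; rewrite in_itv /= => xab.
  by case: (fE x xab).
by move=> c; rewrite in_itv /=; exists c.
Qed.

Lemma is_derive_poly_sub_ln q t : 0 < t ->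
  is_derive t 1 (fun x => q.[x] - ln x) (q^`().[t] - t^-1).
Proof.
move=> t0; have := is_derive1_ln t0; have := is_derive_poly q t => ? ?.
exact: is_deriveB.
Qed.

(** By Rolle, the derivative of q - ln vanishes at [a], [b], at a point between them and at a point
    between [b] and 1. The degree allows no other positive zero, so the signs of the derivative, and
    then of q - ln, are determined. *)
Lemma ln_le_hermite q a b t : 0 < a -> a < b -> b < 1 -> (size q <= 5)%N ->
  q.[1] = 0 -> q.[a] = ln a -> q.[b] = ln b ->
  q^`().[a] = a^-1 -> q^`().[b] = b^-1 -> 0 < t <= 1 -> ln t <= q.[t].
Proof.
move=> a0 ab b1 sq q1 qa qb dqa dqb /andP[t0 t1].
have b0 : 0 < b by lra.
pose g x := q.[x] - ln x; pose dg x := q^`().[x] - x^-1.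
have ga : g a = 0 by rewrite /g qa subrr.
have gb : g b = 0 by rewrite /g qb subrr.
have g1 : g 1 = 0 by rewrite /g q1 ln1 subrr.
have mvt x y : 0 < x -> x < y ->
    exists2 c, x < c < y & g y - g x = dg c * (y - x).
  move=> x0 xy; apply: (@MVT_is_derive g dg) => // z /andP[xz _].
  by apply: is_derive_poly_sub_ln; lra.
have dg_root x y : 0 < x -> x < y -> g x = 0 -> g y = 0 ->
    exists2 c, x < c < y & dg c = 0.
  move=> x0 xy gx gy; have [c cxy] := mvt _ _ x0 xy.
  rewrite gx gy subrr => /esym/eqP; rewrite mulf_eq0 (subr_eq0 y) (gt_eqF xy) orbF.
  by move/eqP; exists c.
have [c1 /andP[ac1 c1b] dgc1] := dg_root _ _ a0 ab ga gb.
have [c2 /andP[bc2 c21] dgc2] := dg_root _ _ b0 b1 gb g1.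
(* Multiplying by x turns the derivative into a polynomial of degree at most 4, with the same sign
   on the positive reals. *)
pose h : {poly R} := 'X * q^`() - 1.
have hE x : 0 < x -> h.[x] = x * dg x.
  by move=> x0; rewrite /h !hornerE /dg mulrBr divff ?gt_eqF.
have sh : (size h <= 5)%N.
  rewrite (leq_trans (size_polyD _ _)) // size_polyN size_poly1 geq_max andbT.
  have [->|nz] := eqVneq q^`() 0; first by rewrite mulr0 size_poly0.
  rewrite mulrC size_mulX // (leq_trans _ sq) //; apply: lt_size_deriv.
  by apply: contraNneq nz => ->; rewrite deriv0.
have [r hr] : exists r : {poly R}, h = r * \prod_(z <- [:: a; c1; b; c2]) ('X - z%:P).
  apply: uniq_roots_prod_XsubC.
    rewrite /= /root !hE; try lra.
    by rewrite dgc1 dgc2 /dg dqa dqb !subrr !mulr0 eqxx.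
  by rewrite uniq_rootsE /= !inE !negb_or !lt_eqF //; lra.
have r0 : r != 0.
  apply/eqP => r0; have := congr1 (fun p => p.[0]) hr.
  by rewrite r0 mul0r /h !hornerE /= => /eqP; rewrite oppr_eq0 oner_eq0.
have sr : (size r <= 1)%N.
  move: sh; rewrite hr size_Mmonic ?monic_prod_XsubC // size_prod_XsubC /=.
  by rewrite addnS /= addn4.
rewrite (size1_polyC sr) in hr; set k := r`_0 in hr.
have hk x : h.[x] = k * ((x - a) * (x - c1) * (x - b) * (x - c2)).
  by rewrite hr !big_cons big_nil !hornerE /=; ring.
(* The sign comes from h(0) = -1, since the product of the four roots is positive. *)
have k0 : k < 0.
  have : h.[0] = -1 by rewrite /h !hornerE ?mul0r ?add0r.
  have P : 0 < a * c1 * b * c2 by rewrite !mulr_gt0 //; lra.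
  rewrite hk => hh; have : k * (a * c1 * b * c2) = -1 by rewrite -hh; ring.
  by move=> kP; rewrite -(pmulr_llt0 _ P) kP ltrN10.
(* [dg] has the sign of [- (x - a) (x - c1) (x - b) (x - c2)] *)
have dg_lt0 x : 0 < x -> 0 < (x - a) * (x - c1) * (x - b) * (x - c2) -> dg x < 0.
  by move=> x0 P; rewrite -(pmulr_rlt0 _ x0) -hE // hk nmulr_rlt0.
have dg_gt0 x : 0 < x -> (x - a) * (x - c1) * (x - b) * (x - c2) < 0 -> 0 < dg x.
  by move=> x0 P; rewrite -(pmulr_rgt0 _ x0) -hE // hk nmulr_rgt0.
suff : 0 <= g t by rewrite /g subr_ge0.
have incr x y : 0 < x -> x < y -> g x = 0 ->
    (forall c, x < c < y -> (c - a) * (c - c1) * (c - b) * (c - c2) < 0) -> 0 <= g y.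
  move=> x0 xy gx H; have [c cxy] := mvt _ _ x0 xy.
  rewrite gx subr0 => ->; apply: mulr_ge0; last by lra.
  by apply/ltW/dg_gt0; [lra | exact: H].
have decr x y : 0 < x -> x < y -> g y = 0 ->
    (forall c, x < c < y -> 0 < (c - a) * (c - c1) * (c - b) * (c - c2)) -> 0 <= g x.
  move=> x0 xy gy H; have [c cxy] := mvt _ _ x0 xy.
  rewrite gy sub0r => e; rewrite -oppr_le0 e; apply: mulr_le0_ge0; last by lra.
  by apply/ltW/dg_lt0; [lra | exact: H].
(* In turn, [g] decreases to its zero at [a], increases up to [c1], decreases to its zero at [b],
   increases up to [c2] and decreases to its zero at 1. *)
have [ta|at_] := ltP t a.
  apply: (decr t a) => // c /andP[tc ca].
  by rewrite -mulrA mulr_gt0; nra.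
have [tc1|c1t] := leP t c1.
  move: at_; rewrite le_eqVlt => /orP[/eqP<-|at_]; first by rewrite ga.
  apply: (incr a t) => // c /andP[tc ca].
  by rewrite -mulrA nmulr_rlt0; nra.
have [tb|bt] := ltP t b.
  apply: (decr t b) => // c /andP[tc ca].
  by rewrite -mulrA mulr_gt0; nra.
have [tc2|c2t] := leP t c2.
  move: bt; rewrite le_eqVlt => /orP[/eqP<-|bt]; first by rewrite gb.
  apply: (incr b t) => // c /andP[tc ca].
  by rewrite -mulrA pmulr_rlt0; nra.
move: t1; rewrite le_eqVlt => /orP[/eqP->|t1]; first by rewrite g1.
by apply: (decr t 1) => // c /andP[tc ca]; rewrite !mulr_gt0; lra.
Qed.

(* The interpolant is [l + w r] where [l] is linear, [w = (X - a) (X - b)] and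
   [r = r1 + (X - 1) (al + be X)]; a functional [m] for which [w] is orthogonal
   to [X - 1] and [(X - 1) X] does not see [al] and [be]. *)
Lemma hermite_ln_quadrature a b : 0 < a -> a < b -> b < 1 ->
  exists q, [/\ (size q <= 5)%N, forall t, 0 < t <= 1 -> ln t <= q.[t] &
    forall m : nat -> R,
      m 3 - (1 + (a + b)) * m 2 + (a + b + a * b) * m 1 - a * b * m 0 = 0 ->
      m 4 - (1 + (a + b)) * m 3 + (a + b + a * b) * m 2 - a * b * m 1 = 0 ->
      \sum_(j < 5) q`_j * m j =
        (let l1 := (ln b - ln a) / (b - a) in let l0 := ln a - a * l1 in
         l0 * m 0 + l1 * m 1 -
         (l0 + l1) * (m 2 - (a + b) * m 1 + a * b * m 0) / ((1 - a) * (1 - b)))].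
Proof.
move=> a0 ab b1.
set A := ln a; set B := ln b.
set l1 := (B - A) / (b - a); set l0 := A - a * l1.
(* [r1] is forced by the value 0 at 1; [ua] and [ub] are the values of al + be X at [a] and [b]
   forced by the derivatives there. *)
set r1 := - (l0 + l1) / ((1 - a) * (1 - b)).
set ua := ((a^-1 - l1) / (a - b) - r1) / (a - 1).
set ub := ((b^-1 - l1) / (b - a) - r1) / (b - 1).
set be := (ub - ua) / (b - a); set al := ua - be * a.
have [ba_0 ab_0] : b - a != 0 /\ a - b != 0 by split; apply/eqP; lra.
have [a1 b_1 a_1 b1_] : [/\ 1 - a != 0, 1 - b != 0, a - 1 != 0 & b - 1 != 0].
  by split; apply/eqP; lra.
pose s := [:: l0 + a * b * (r1 - al); l1 + a * b * (al - be) - (a + b) * (r1 - al);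
  a * b * be - (a + b) * (al - be) + (r1 - al); al - be - (a + b) * be; be].
pose q := Poly s.
have dq : q^`() = Poly [:: s`_1; s`_2 *+ 2; s`_3 *+ 3; s`_4 *+ 4].
  apply/polyP => i; rewrite coef_deriv !coef_Poly.
  by case: i => [|[|[|[|i]]]] //=; rewrite nth_nil mul0rn.
have qE t : q.[t] = l0 + l1 * t + (t - a) * (t - b) * (r1 + (t - 1) * (al + be * t)).
  by rewrite horner_Poly /=; ring.
have dqE t : q^`().[t] = l1 + (t - a + (t - b)) * (r1 + (t - 1) * (al + be * t))
    + (t - a) * (t - b) * (al + be * t + (t - 1) * be).
  by rewrite dq horner_Poly /=; ring.
have ala : al + be * a = ua by rewrite /al subrK.
have alb : al + be * b = ub.
  by rewrite /al -addrA [- _ + _]addrC -mulrBr /be divfK // addrC subrK.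
exists q; split; first exact: size_Poly.
- move=> t; apply: (@ln_le_hermite q a b) => //.
  + exact: size_Poly.
  + by rewrite qE /r1; field; rewrite a1 b_1.
  + by rewrite qE subrr !mul0r addr0 /l0 -/A [l1 * a]mulrC subrK.
  + by rewrite qE subrr mulr0 mul0r addr0 /l0 /l1 -/B; field.
  + by rewrite dqE subrr !mul0r addr0 add0r ala /ua [(a - 1) * _]mulrC divfK //
      [r1 + _]addrC subrK [(a - b) * _]mulrC divfK // addrC subrK.
  + by rewrite dqE subrr mulr0 !mul0r !addr0 alb /ub [(b - 1) * _]mulrC divfK //
      [r1 + _]addrC subrK [(b - a) * _]mulrC divfK // addrC subrK.
move=> m o1 o2; rewrite !big_ord_recl big_ord0 /= !coef_Poly /= /bump /=.
(* The two brackets multiplied by [al] and [be] are the functional at (X - 1) w and X (X - 1) w,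
   which the hypotheses make 0. *)
transitivity (l0 * m 0%N + l1 * m 1%N + r1 * (m 2 - (a + b) * m 1%N + a * b * m 0%N)
  + (al * (m 3 - (1 + (a + b)) * m 2 + (a + b + a * b) * m 1%N - a * b * m 0%N) +
   be * (m 4 - (1 + (a + b)) * m 3 + (a + b + a * b) * m 2 - a * b * m 1%N))).
  by rewrite !add1n; ring.
by rewrite o1 o2 !mulr0 !addr0 /r1 -/l1 -/l0; ring.
Qed.

End HermiteLog.

(** * Moments of a design and the closed form of the bound *)

Section W5.
Context {R : realType}.

Lemma design_moment_rec d j : (0 < d)%N ->
  d%:R / 'C(d.-1 + j.+2, j.+2)%:R =
  d%:R / 'C(d.-1 + j.+1, j.+1)%:R * ((j.+2)%:R / (d + j.+1)%:R) :> R.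
Proof.
case: d => // n _ /=.
have := mul_bin_diag (n + j.+2) j.+1.
rewrite !addnS !addSn /= => /(congr1 (fun m => m%:R : R)); rewrite !natrM => E.
have -> : 'C((n + j).+2, j.+2)%:R = (n + j).+2%:R * 'C((n + j).+1, j.+1)%:R / j.+2%:R :> R.
  by rewrite E mulrC mulKf // pnatr_eq0.
rewrite invf_div mulf_div mulrA; congr (_ / _); exact: mulrC.
Qed.

Lemma W5_ln_majorant d : (0 < d)%N -> exists q : {poly R}, [/\ (size q <= 5)%N,
  forall t, 0 < t <= 1 -> ln t <= q.[t] &
  ln d%:R + \sum_(j < 5) q`_j * (d%:R / 'C(d.-1 + j.+1, j.+1)%:R) = W5 R d].
Proof.
move=> d0; set D : R := d%:R.
have D1 : 1 <= D by rewrite /D ler1n.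
(* Naming the square roots leaves identities of rational functions in [D], [u], [v], [w], to be
   checked by [field]. *)
pose u := Num.sqrt (D + 1); pose v := Num.sqrt (D + 3); pose w := Num.sqrt (3 : R).
have u0 : 0 < u by rewrite sqrtr_gt0; lra.
have v0 : 0 < v by rewrite sqrtr_gt0; lra.
have w0 : 0 < w by rewrite sqrtr_gt0; lra.
have u2 : u * u = D + 1 by rewrite -expr2 sqr_sqrtr //; lra.
have v2 : v * v = D + 3 by rewrite -expr2 sqr_sqrtr //; lra.
have w2 : w * w = 3 by rewrite -expr2 sqr_sqrtr //; lra.
have uv : u < v by rewrite ltr_sqrt; lra.
pose s := w * u / v.
have s0 : 0 < s by rewrite divr_gt0 ?mulr_gt0.
have s2 : s * s = 3 * (D + 1) / (D + 3).
  rewrite -[in RHS]u2 -[in RHS]v2 -[X in X * _ / _]w2 /s; field; apply/eqP; lra.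
have sw : s < w.
  by rewrite /s ltr_pdivrMr // ltr_pM2l.
have w2' : w < 2.
  have : w * w < 2 * 2 by rewrite w2; lra.
  by rewrite -!expr2 ltr_pXn2r // nnegrE; lra.
(* These are the roots of X^2 - 6 / (D + 4) X + 6 / ((D + 3) (D + 4)), the quadratic for which [o1]
   and [o2] hold. *)
pose a := (3 - s) / (D + 4); pose b := (3 + s) / (D + 4).
have a0 : 0 < a by rewrite divr_gt0; lra.
have ab : a < b by rewrite ltr_pM2r ?invr_gt0; lra.
have b1 : b < 1 by rewrite ltr_pdivrMr; lra.
have e1 : a + b = 6 / (D + 4) by rewrite /a /b; field; apply/eqP; lra.
have e2 : a * b = 6 / ((D + 3) * (D + 4)).
  transitivity ((9 - s * s) / ((D + 4) * (D + 4))).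
    by rewrite /a /b; field; apply/eqP; lra.
  by rewrite s2; field; apply/andP; split; apply/eqP; lra.
have [q [sq lnq mq]] := hermite_ln_quadrature a0 ab b1.
exists q; split => //.
(* [m j] is the design moment of order j + 1: the extra power is the factor t in t Q(t). *)
pose m j : R := d%:R / 'C(d.-1 + j.+1, j.+1)%:R.
have mS j : m j.+1 = m j * (j.+2%:R / (D + j.+1%:R)).
  by rewrite /m design_moment_rec // natrD.
have m0 : m 0%N = 1.
  by rewrite /m bin1 addn1 prednK // divff // pnatr_eq0 -lt0n.
have m1 : m 1%N = 2 / (D + 1) by rewrite mS m0 mul1r.
have m2 : m 2%N = 6 / ((D + 1) * (D + 2)).
  by rewrite mS m1; field; apply/andP; split; apply/eqP; lra.
have m3 : m 3%N = 24 / ((D + 1) * (D + 2) * (D + 3)).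
  by rewrite mS m2; field; repeat (apply/andP; split); apply/eqP; lra.
have m4 : m 4%N = 120 / ((D + 1) * (D + 2) * (D + 3) * (D + 4)).
  by rewrite mS m3; field; repeat (apply/andP; split); apply/eqP; lra.
have o1 : m 3 - (1 + (a + b)) * m 2 + (a + b + a * b) * m 1%N - a * b * m 0%N = 0.
  by rewrite m0 m1 m2 m3 e1 e2; field; repeat (apply/andP; split); apply/eqP; lra.
have o2 : m 4 - (1 + (a + b)) * m 3 + (a + b + a * b) * m 2 - a * b * m 1%N = 0.
  by rewrite m1 m2 m3 m4 e1 e2; field; repeat (apply/andP; split); apply/eqP; lra.
have -> : \sum_(j < 5) q`_j * (D / 'C(d.-1 + j.+1, j.+1)%:R) = \sum_(j < 5) q`_j * m j.
  by [].
rewrite (mq m o1 o2) /=.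
have b0 : 0 < b by lra.
(* The two logarithms in [W5] are ln (a b) and ln (a / b). *)
have lnab : ln (6 / ((D + 3) * (D + 4))) = ln a + ln b by rewrite -e2 lnM.
have lnab' : ln ((2 * D + 5 - Num.sqrt (3 * (D + 1) * (D + 3))) / (D + 4))
    = ln a - ln b.
  rewrite -ln_div ?posrE //; congr ln.
  have -> : Num.sqrt (3 * (D + 1) * (D + 3)) = w * u * v.
    by rewrite !sqrtrM //; lra.
  have -> : w * u * v = s * (D + 3) by rewrite -v2 /s; field; apply/eqP; lra.
  have P : 9 - s * s = 6 * (D + 4) / (D + 3).
    by rewrite s2; field; apply/eqP; lra.
  have -> : a / b = (3 - s) / (3 + s).
    by rewrite /a /b; field; apply/andP; split; apply/eqP; lra.
  apply/eqP; rewrite eqr_div; try by apply/eqP; lra.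
  apply/eqP.
  have : s * s * (D + 3) = 3 * (D + 1) by rewrite s2 divfK //; apply/eqP; lra.
  nra.
have pw : (D + 1) `^ (3 / 2) = u * (D + 1).
  have -> : 3 / 2 = 2^-1 + 1 :> R by field.
  rewrite powRD; last by apply/implyP => /eqP; lra.
  by rewrite powRr1 ?powR12_sqrt //; lra.
rewrite /W5 -/D lnab lnab' pw -/v -/w.
have -> : (1 - a) * (1 - b) = D * (D + 1) / ((D + 3) * (D + 4)).
  transitivity (1 - (a + b) + a * b); first by ring.
  by rewrite e1 e2; field; apply/andP; split; apply/eqP; lra.
have ba : b - a = 2 * s / (D + 4) by rewrite /a /b; field; apply/eqP; lra.
rewrite m0 m1 m2 mulr1 e2 e1.
set A := ln a; set B := ln b; set L := ln D.
set l1 := (B - A) / (b - a).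
(* Writing a = ((a + b) - (b - a)) / 2 leaves [l1] as the only irrational coefficient of the
   logarithms. *)
have al1 : a * l1 = (6 / (D + 4) * l1 - (B - A)) / 2.
  rewrite -e1 /l1; field; apply/eqP; lra.
rewrite al1.
have -> : l1 = (B - A) * (D + 4) * v / (2 * w * u).
  by rewrite /l1 ba /s; field; repeat (apply/andP; split); apply/eqP; lra.
field; repeat (apply/andP; split); apply/eqP; lra.
Qed.
End W5.

(** * Operators and designs *)

Local Open Scope complex_scope.
Local Open Scope sesquilinear_scope.

Section Matrices.
Context {R : realType}.
Local Notation C := R[i].

Definition qform n (A : 'M[C]_n) (v : 'cV[C]_n) : C := (v^t* *m A *m v) 0 0.

Lemma ge0_complexE (z : C) : 0 <= z -> z = (complex.Re z)%:C.
Proof. by case: z => a b; rewrite lecE /= => /andP[/eqP-> _]. Qed.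

Lemma Re_ge0 (z : C) : 0 <= z -> 0 <= complex.Re z.
Proof. by rewrite lecE => /andP[]. Qed.

Lemma le_Re (x y : C) : x <= y -> complex.Re x <= complex.Re y.
Proof. by rewrite lecE => /andP[]. Qed.

(** The spectral theorem in the form of trace formulas, with [l] the eigenvalues and [v] an
    orthonormal eigenbasis. *)
Lemma psdmx_spectral n (A : 'M[C]_n) : psdmx A ->
  exists (l : 'I_n -> R) (v : 'I_n -> 'cV[C]_n),
  [/\ forall i, 0 <= l i, forall i, (v i)^t* *m v i = 1%:M,
      forall B, \tr B = \sum_i qform B (v i) &
      forall B, \tr (A *m B) = \sum_i (l i)%:C * qform B (v i)].
Proof.
move=> [hA pA]; have /hermitian_normalmx/orthomx_spectralP := hA.
set U := spectralmx A; set D := spectral_diag A.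
have Uu : U \is unitarymx := spectral_unitarymx A.
have UU := unitarymxP Uu.
have UtU : U^t* *m U = 1%:M by rewrite -invmx_unitary // mulVmx ?spectral_unit.
rewrite invmx_unitary // => AE.
(* As [A] is the adjoint of [U] times a diagonal matrix times [U], the adjoints of the rows of [U]
   are eigenvectors. *)
pose v i : 'cV[C]_n := (row i U)^t*.
have vE i : (v i)^t* = row i U.
  by rewrite /v; apply/matrixP => a b; rewrite !mxE conjCK.
have qE B i : qform B (v i) = (U *m B *m U^t*) i i.
  rewrite /qform vE -row_mul /v; rewrite !mxE.
  by apply: eq_bigr => j _; rewrite !mxE.
have DE i : D 0 i = qform A (v i).
  rewrite qE AE !mulmxA UU mul1mx -mulmxA UU mulmx1.
  by rewrite mxE eqxx mulr1n.
exists (fun i => complex.Re (D 0 i)), v; split.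
- by move=> i; rewrite DE; apply/Re_ge0/pA.
- move=> i; apply/matrixP => a b; rewrite !ord1 vE.
  have <- : (U *m U^t*) i i = (1%:M : 'M[C]_1) 0 0 by rewrite UU !mxE eqxx.
  by rewrite /v !mxE; apply: eq_bigr => j _; rewrite !mxE.
- move=> B; rewrite -[B in LHS]mulmx1 -UtU mulmxA mxtrace_mulC mulmxA.
  by apply: eq_bigr => i _; rewrite qE.
- move=> B; rewrite {1}AE -!mulmxA mxtrace_mulC -!mulmxA.
  apply: eq_bigr => i _; rewrite qE -ge0_complexE; last by rewrite DE; exact: pA.
  by rewrite mul_diag_mx mxE mulmxA.
Qed.

Lemma psdmx_trace_ge0 n (A : 'M[C]_n) : psdmx A -> 0 <= \tr A.
Proof.
move=> pA; have [l [v [_ _ -> _]]] := psdmx_spectral pA.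
by apply: sumr_ge0 => i _; case: pA => _; exact.
Qed.

Lemma psdmx_traceM_ge0 n (A B : 'M[C]_n) : psdmx A -> psdmx B ->
  0 <= \tr (A *m B).
Proof.
move=> pA [_ pB]; have [l [v [l0 _ _ ->]]] := psdmx_spectral pA.
by apply: sumr_ge0 => i _; apply: mulr_ge0 (pB _); rewrite ler0c.
Qed.

Lemma effect_traceM_le n (A B : 'M[C]_n) : psdmx A -> is_effect B ->
  \tr (A *m B) <= \tr A.
Proof.
move=> pA [_ pB]; have := psdmx_traceM_ge0 pA pB.
by rewrite mulmxBr mulmx1 linearB /= subr_ge0.
Qed.

Lemma psdmx_traceM_le n (A B : 'M[C]_n) : psdmx A -> psdmx B ->
  \tr (A *m B) <= \tr A * \tr B.
Proof.
move=> pA [_ pB]; have [l [v [l0 v1 trv trA]]] := psdmx_spectral pA.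
rewrite -{2}[A]mulmx1 !trA mulr_suml; apply: ler_sum => i _.
rewrite -mulrA ler_wpM2l ?ler0c // {2}/qform mulmx1 v1 mxE eqxx mul1r.
by rewrite trv (bigD1 i) //= lerDl sumr_ge0 // => j _; exact: pB.
Qed.

(** * Tensor powers and the symmetric subspace *)

Section TensorPowers.
Variable d : nat.
Implicit Types (A : 'M[C]_d) (v : 'cV[C]_d) (k : nat).

Definition tensor_vec k v : 'cV[C]_(tensor_dim d k) :=
  \col_i \prod_(l < k) v ((enum_val i : {ffun 'I_k -> 'I_d}) l) 0.

Lemma sym_tensor_vec k v : sym_tensor (tensor_vec k v).
Proof.
move=> s f; rewrite !mxE !enum_rankK.
rewrite [RHS](reindex_inj (@perm_inj _ s)) /=.
by apply: eq_bigr => l _; rewrite ffunE.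
Qed.

Lemma sum_tensor_index k (F : {ffun 'I_k -> 'I_d} -> C) :
  \sum_(i < tensor_dim d k) F (enum_val i) = \sum_f F f.
Proof. by rewrite [RHS]big_enum_val. Qed.

Lemma qform_tensor k A v :
  qform (tensor_pow k A) (tensor_vec k v) = qform A v ^+ k.
Proof.
have qE n (B : 'M[C]_n) w :
    qform B w = \sum_i \sum_j (w i 0)^* * B i j * w j 0.
  rewrite /qform mxE exchange_big /=; apply: eq_bigr => j _.
  by rewrite mxE mulr_suml; apply: eq_bigr => i _; rewrite !mxE.
rewrite !qE -[k in RHS]card_ord -prodr_const.
(* A product of k sums is a sum over functions from k factors to basis indices, that is, over the
   tensor basis. *)
rewrite bigA_distr_bigA /= -sum_tensor_index; apply: eq_bigr => i _.
rewrite bigA_distr_bigA /= -sum_tensor_index; apply: eq_bigr => j _.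
by rewrite !mxE rmorph_prod -!big_split.
Qed.

Lemma tensor_vec_norm k v : v^t* *m v = 1%:M ->
  (tensor_vec k v)^t* *m tensor_vec k v = 1%:M.
Proof.
move=> v1; apply/matrixP => a b; rewrite !ord1 !mxE eqxx /= mulr1n.
have E : \sum_i (v i 0)^* * v i 0 = 1.
  transitivity ((v^t* *m v) 0 0); last by rewrite v1 mxE eqxx.
  by rewrite mxE; apply: eq_bigr => i _; rewrite !mxE.
have <- : \prod_(l < k) (\sum_i (v i 0)^* * v i 0) = 1.
  by rewrite big1 // => _ _; rewrite E.
rewrite bigA_distr_bigA /= -sum_tensor_index; apply: eq_bigr => i _.
by rewrite !mxE rmorph_prod -!big_split.
Qed.

Lemma qform_orthogonal_projector n (V : 'cV[C]_n -> Prop) (P : 'M[C]_n) w :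
  orthogonal_projector V P -> V w -> w^t* *m w = 1%:M -> qform P w = 1.
Proof.
move=> [_ PP VP] /VP[u ->] w1.
by rewrite /qform -mulmxA mulmxA -mulmxA [P *m (P *m u)]mulmxA PP w1 mxE eqxx.
Qed.

End TensorPowers.

(** This puts a quadratic form into the shape Tr (B A), which commutes with entrywise
    integration. *)
Lemma qform_trace n (A : 'M[C]_n) v : qform A v = \tr (v *m v^t* *m A).
Proof. by rewrite -mulmxA mxtrace_mulC /qform /mxtrace big_ord1. Qed.

Local Notation mu := (@lebesgue_measure R).

Lemma Re_sum I (r : seq I) (F : I -> C) :
  complex.Re (\sum_(i <- r) F i) = \sum_(i <- r) complex.Re (F i).
Proof. by elim/big_rec2: _ => // i y x _ <-; case: (F i) => ? ?; case: x. Qed.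

Lemma Re_traceM n (B A : 'M[C]_n) : complex.Re (\tr (B *m A)) =
  \sum_i \sum_j (complex.Re (B i j) * complex.Re (A j i)
                 - complex.Im (B i j) * complex.Im (A j i)).
Proof.
rewrite Re_sum; apply: eq_bigr => i _; rewrite mxE Re_sum.
by apply: eq_bigr => j _; case: (B i j) => ? ?; case: (A j i).
Qed.

Lemma has_integral_mx_trace n (B : 'M[C]_n) (F : R -> 'M[C]_n) :
  integrable_mx F ->
  has_integral mu (fun y => complex.Re (\tr (B *m F y)))
    (complex.Re (\tr (B *m integral_mx F))).
Proof.
move=> iF; under [X in has_integral _ X]eq_fun do rewrite Re_traceM.
rewrite Re_traceM; apply: has_integral_sum => i; apply: has_integral_sum => j.
have [re im] := iF j i; rewrite /integral_mx mxE /=.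
by apply: has_integralB; apply: has_integralZ; apply: integrable_has_integral.
Qed.

(** The design identity is tested on the k-th tensor power of [v], a symmetric unit vector, on which
    the projector has quadratic form 1. *)
Lemma design_moment d t (p : R -> 'M[C]_d) k (v : 'cV[C]_d) :
  design_povm t p -> (1 <= k <= t)%N -> v^t* *m v = 1%:M ->
  let S y := complex.Re (qform (p y) v) in
  let T y := complex.Re (\tr (p y)) in
  has_integral mu (fun y => S y ^+ k / T y ^+ k.-1) (d%:R / 'C(d.-1 + k, k)%:R).
Proof.
move=> [[_ ep _ _] dp] kt v1 S T.
have [iF [P PV PE]] := dp k kt.
set w := tensor_vec k v.
have E y : S y ^+ k / T y ^+ k.-1 =
    complex.Re (\tr (w *m w^t* *m design_integrand k p y)).
  have [pp _] := ep y.
  rewrite -qform_trace /design_integrand /qform -scalemxAr -scalemxAl mxE.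
  rewrite -/(qform _ _) qform_tensor.
  rewrite (ge0_complexE (psdmx_trace_ge0 pp)) -/(T y).
  have /ge0_complexE -> : 0 <= qform (p y) v by case: pp => _; exact.
  by rewrite -/(S y) -!rmorphXn -fmorphV -rmorphM /= mulrC.
under [X in has_integral _ X]eq_fun do rewrite E.
have := has_integral_mx_trace (w *m w^t*) iF; congr has_integral.
rewrite PE -qform_trace /qform -scalemxAr -scalemxAl mxE -/(qform _ _).
rewrite (qform_orthogonal_projector PV (sym_tensor_vec v) (tensor_vec_norm k v1)).
rewrite mulr1 -[d%:R](rmorph_nat (real_complex R)).
by rewrite -[X in _ / X](rmorph_nat (real_complex R)) -fmorphV -rmorphM.
Qed.

End Matrices.

(** * Entropy integrals for a 5-design *)

Section Design.
Context {R : realType}.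
Local Notation C := R[i].
Local Notation mu := (@lebesgue_measure R).

(** The right-hand side is s Q(s / T) with Q = [q], written in the functions whose integrals are the
    design moments. *)
Lemma pure_entropy_le (q : {poly R}) (s T : R) : (size q <= 5)%N ->
  (forall t, 0 < t <= 1 -> ln t <= q.[t]) -> 0 <= s <= T ->
  s * ln (s / T) <= \sum_(j < 5) q`_j * (s ^+ j.+1 / T ^+ j).
Proof.
move=> sq lnq /andP[]; rewrite le_eqVlt => /predU1P[<- _|s0 sT].
  by rewrite mul0r sumr_ge0 // => j _; rewrite exprS !mul0r mulr0.
have T0 : 0 < T by exact: lt_le_trans sT.
have := lnq (s / T); rewrite divr_gt0 // ler_pdivrMr // mul1r sT => /(_ isT).
rewrite -(ler_pM2l s0) (horner_coef_wide _ sq) mulr_sumr => /le_trans; apply.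
apply: ler_sum => j _; rewrite exprS expr_div_n.
by rewrite le_eqVlt; apply/orP; left; apply/eqP; ring.
Qed.

(** The log-sum inequality reduces to the eigenvectors of [A]. Each contributes the same moment sum,
    weighted by its eigenvalue, and the eigenvalues add up to the trace. *)
Lemma psdmx_entropy_le d (p : R -> 'M[C]_d) (A : 'M[C]_d) (q : {poly R}) :
  design_povm 5 p -> psdmx A -> (size q <= 5)%N ->
  (forall t, 0 < t <= 1 -> ln t <= q.[t]) ->
  (\int[mu]_y (complex.Re (\tr (A *m p y)) *
     ln (complex.Re (\tr (A *m p y)) /
         (complex.Re (\tr A) * complex.Re (\tr (p y)))))%:E <=
   (complex.Re (\tr A) * \sum_(j < 5) q`_j * (d%:R / 'C(d.-1 + j.+1, j.+1)%:R))%:E)%E.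
Proof.
move=> dp pA sq lnq.
set P := complex.Re (\tr A); pose T y := complex.Re (\tr (p y)).
pose f y := complex.Re (\tr (A *m p y)).
rewrite -[X in (X <= _)%E]/(\int[mu]_y (f y * ln (f y / (P * T y)))%:E)%E.
have [[_ ep ip _] _] := dp.
have [l [v [l0 v1 trv trA]]] := psdmx_spectral pA.
pose s i y := complex.Re (qform (p y) (v i)).
have s0 i y : 0 <= s i y by apply: Re_ge0; case: (ep y) => -[_ + _]; apply.
have fE y : f y = \sum_i l i * s i y.
  rewrite /f trA Re_sum; apply: eq_bigr => i _; rewrite /s.
  by case: (qform _ _) => a b /=; rewrite mul0r subr0.
have PE : P = \sum_i l i.
  rewrite /P -[A]mulmx1 trA Re_sum; apply: eq_bigr => i _.
  by rewrite /qform mulmx1 v1 mxE eqxx /= mulr1 mul0r subr0.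
have TE y : T y = \sum_i s i y by rewrite /T trv Re_sum.
have sT i y : 0 <= s i y <= T y.
  by rewrite s0 TE (bigD1 i) //= lerDl sumr_ge0.
have T0 y : 0 <= T y by rewrite TE sumr_ge0.
have P0 : 0 <= P by rewrite PE sumr_ge0.
have mf : measurable_fun [set: R] f := has_integral_measurable (has_integral_mx_trace A ip).
have mT : measurable_fun [set: R] T.
  have := has_integral_measurable (has_integral_mx_trace 1%:M ip).
  by under eq_fun do rewrite mul1mx.
pose g y := \sum_i l i * \sum_(j < 5) q`_j * (s i y ^+ j.+1 / T y ^+ j).
have hg : has_integral mu g
    (\sum_i l i * \sum_(j < 5) q`_j * (d%:R / 'C(d.-1 + j.+1, j.+1)%:R)).
  apply: has_integral_sum => i; apply: has_integralZ.
  apply: has_integral_sum => j; apply: has_integralZ.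
  (* The condition 1 <= j + 1 <= 5 computes to j < 5, so degree 4 in [q] uses exactly the moments up
     to order 5. *)
  exact: (@design_moment R d 5 p j.+1 (v i) dp (ltn_ord j) (v1 i)).
rewrite PE mulr_suml; apply: ae_le_integral_has_integral hg _.
  apply: measurable_funM => //; apply: (measurableT_comp (@measurable_ln R)).
  apply: measurable_funM => //; apply: measurable_funV => [|y].
    exact: measurable_funM.
  by rewrite -PE mulr_ge0.
apply: aeW => y; rewrite fE (le_trans (log_sum_le l0 (sT ^~ y))) //.
by apply: ler_sum => i _; apply: ler_wpM2l => //; exact: pure_entropy_le.
Qed.

End Design.

Theorem corollary5 (R : realType) (d : nat) (hd : (0 < d)%N)
    (p : R -> 'M[R[i]]_d) (hp : design_povm 5 p) :
  (informational_power p <= (W5 R d)%:E)%E.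
Proof.
have [[mp ep ip p1] _] := hp.
(* [W5] becomes ln d plus the moment sum of [q], which plays the part of [K] below. *)
have [q [sq lnq <-]] := @W5_ln_majorant R d hd.
apply: ge_ereal_sup => _ [rho [mrho srho rho1] <-].
rewrite /mutual_information /marginal_x /marginal_y.
have prho x : psdmx (rho x) by case: (srho x).
have pp y : psdmx (p y) by case: (ep y).
pose P x := complex.Re (\tr (rho x)); pose T y := complex.Re (\tr (p y)).
have P0 x : 0 <= P x by exact/Re_ge0/psdmx_trace_ge0.
apply: (@mutual_information_le _ _ _ _ R lebesgue_measure lebesgue_measure
          (joint_density rho p) P T d%:R).
- rewrite /joint_density; under eq_fun do rewrite Re_traceM.
  apply: measurable_sum => i; apply: measurable_sum => j.
  have [mr1 mr2] := mrho i j; have [mp1 mp2] := mp j i.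
  apply: measurable_funB; apply: measurable_funM.
  + exact: (measurableT_comp mr1 measurable_fst).
  + exact: (measurableT_comp mp1 measurable_snd).
  + exact: (measurableT_comp mr2 measurable_fst).
  + exact: (measurableT_comp mp2 measurable_snd).
- by move=> x y; apply/Re_ge0/psdmx_traceM_ge0.
- by move=> x y; apply/le_Re/effect_traceM_le.
- move=> x y; rewrite /joint_density.
  have := psdmx_traceM_le (prho x) (pp y).
  (* Both traces are nonnegative, hence equal to their real parts, so the complex inequality passes
     to the product of the real parts. *)
  rewrite (ge0_complexE (psdmx_trace_ge0 (prho x))) (ge0_complexE (psdmx_trace_ge0 (pp y))).
  by rewrite -rmorphM => /le_Re.
- by move=> y; exact/Re_ge0/psdmx_trace_ge0.
- by rewrite ltr0n.
- apply: ge0_has_integral => //; rewrite /P.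
  under eq_fun do rewrite Re_sum.
  by apply: measurable_sum => i; case: (mrho i i).
(* The effects integrate to the identity, so their traces integrate to d. *)
- have := has_integral_mx_trace 1%:M ip; rewrite p1 mul1mx mxtrace1.
  rewrite -[d%:R](rmorph_nat (real_complex R)) /=; congr has_integral.
  by apply/funext => y; rewrite mul1mx.
- move=> x; have [_ ->] := has_integral_mx_trace (rho x) ip.
  by rewrite p1 mulmx1.
- by move=> x; exact: psdmx_entropy_le.
Qed.
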